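(* Let $n \ge 2$ be an integer, let $C_n$ denote the cyclic group of order $n$ (written multiplicatively), and let $A=[1,n-1]=\{1,2,\dots,n-1\}$. Then ${\sf C}_A(C_n^2)=4$.
   Context: For a group $G$ (written multiplicatively, identity $1$) and a nonempty set $A$ of positive integers, a sequence over $G$ of length $k$ is an ordered finite list $S=(g_1,\dots,g_k)$ of elements of $G$ (repetitions allowed). We say that $S$ has an $A$-weighted consecutive product-one subsequence if there exist $1\le i\le j\le k$ and $a_i,a_{i+1},\dots,a_j\in A$ (chosen independently, repetitions allowed) such that $g_i^{a_i}g_{i+1}^{a_{i+1}}\cdots g_j^{a_j}=1$. The constant ${\sf C}_A(G)$ is the smallest positive integer $\ell$ such that every sequence over $G$ of length at least $\ell$ has an $A$-weighted consecutive product-one subsequence. *)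

(* Defs.v *)
From mathcomp Require Import all_boot all_fingroup all_solvable.

Set Implicit Arguments.
Unset Strict Implicit.
Unset Printing Implicit Defensive.

Local Open Scope group_scope.

(* The sequence is indexed from 0, so the block is S_i, ..., S_j with
   i <= j < size S.  The product is the ordered (left-to-right) group product,
   and only the values of [a] on [i, j] matter. *)
Definition has_weighted_consecutive_product_one
    (G : groupType) (A : nat -> Prop) (S : seq G) : Prop :=
  exists (i j : nat) (a : nat -> nat),
    [/\ (i <= j)%N, (j < size S)%N,
        forall t : nat, (i <= t <= j)%N -> A (a t)
      & \prod_(i <= t < j.+1) nth 1 S t ^+ a t = 1].

Definition weighted_consecutive_bound
    (G : groupType) (A : nat -> Prop) (l : nat) : Prop :=
  forall S : seq G, (l <= size S)%N -> has_weighted_consecutive_product_one A S.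

(* C_A(G) = l, as a relation: nothing is assumed about the existence of the
   minimum for an arbitrary G, so proving it includes proving existence. *)
Definition is_weighted_C (G : groupType) (A : nat -> Prop) (l : nat) : Prop :=
  [/\ (0 < l)%N, weighted_consecutive_bound G A l
    & forall m : nat, (0 < m)%N -> weighted_consecutive_bound G A m ->
        (l <= m)%N].

(* Main.v *)
Require Import Defs.
From mathcomp Require Import all_boot all_fingroup all_solvable.

(** Lower bound: for independent generators [u], [v] of the two factors, the
    sequence [u, v, u] has no weighted consecutive product-one subsequence,
    because the second coordinate vanishes only on blocks avoiding [v].
    Upper bound: among four terms [x, y, z, w] one may assume that all have
    order [n] and that consecutive ones generate subgroups with trivial
    intersection, hence, by counting, the whole group.  Writing
    [z = x^a y^b], either [x, y, z] or [y, z] is a good block, or [z] is a power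
    of [x]; likewise [w] is a power of [y], and then [x, y, z, w] is a good
    block. *)

Set Implicit Arguments.
Unset Strict Implicit.
Unset Printing Implicit Defensive.

Local Open Scope group_scope.

(** Lets a block be exhibited by its start and an explicit nonempty list of weights, whose length
    fixes where the block ends. *)
Lemma weighted_block (G : groupType) (A : nat -> Prop) (S : seq G) (i : nat)
    (e : seq nat) :
  0 < size e -> i + size e <= size S -> (forall k, k \in e -> A k) ->
  \prod_(0 <= t < size e) nth 1 S (i + t) ^+ nth 0 e t = 1 ->
  has_weighted_consecutive_product_one A S.
Proof.
move=> e_gt0 le_e_S Ae prod1.
exists i, (i + (size e).-1), (fun t => nth 0 e (t - i)); split.
- exact: leq_addr.
- by rewrite -addnS prednK.
- move=> t /andP[le_it le_t]; apply/Ae/mem_nth.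
  by rewrite ltn_subLR // -(prednK e_gt0) addnS ltnS.
rewrite -addnS prednK // -{1}[i]add0n big_addn addKn -[RHS]prod1.
by apply: eq_bigr => t _; rewrite addnK addnC.
Qed.

Section ExponentN.

Variables (G : finGroupType) (n : nat).
Hypotheses (abG : abelian [set: G]) (n_gt1 : 1 < n).
Hypotheses (expG : forall x : G, x ^+ n = 1) (cardG : #|[set: G]| = (n ^ 2)%N).

Let weight (a : nat) : Prop := 1 <= a <= n - 1.

Let commG (x y : G) : commute x y.
Proof. by apply: (centsP abG); rewrite inE. Qed.

Let weight_lt a : 0 < a -> a < n -> weight a.
Proof. by move=> a0 an; rewrite /weight a0 subn1 -ltnS prednK // ltnW. Qed.

(** Weights cannot be negative, so [n - a] plays the part of [-a]; it is admissible exactly because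
    [a] is neither 0 nor [n]. *)
Let weight_sub a : 0 < a -> a < n -> weight (n - a).
Proof. by move=> a0 an; apply: weight_lt; rewrite ?subn_gt0 ?ltn_subrL ?a0 ?(ltnW n_gt1). Qed.

Let weight1 : weight 1.
Proof. exact: weight_lt. Qed.

Let expg_subn (x : G) a : a < n -> x ^+ (n - a) = (x ^+ a)^-1.
Proof. by move=> an; rewrite expgnFr ?(ltnW an) // expG mul1g. Qed.

(** An order below [n] is itself an admissible weight that kills [x]. *)
Lemma order_eq_or_weight (x : G) :
  #[x] = n \/ exists2 a, weight a & x ^+ a = 1.
Proof.
have : #[x] <= n by rewrite dvdn_leq ?(ltnW n_gt1) // order_dvdn expG.
rewrite leq_eqVlt => /orP[/eqP|lt_xn]; first by left.
by right; exists #[x]; [apply: weight_lt | apply: expg_order].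
Qed.

(** If the two cycles meet trivially, their product has [n * n] elements and so is all of [G].
    Otherwise a common element [x ^+ a = y ^+ b] other than 1 gives the weights [n - a] and [b]. *)
Lemma span_or_weight (x y : G) : #[x] = n -> #[y] = n ->
  (exists a b, [/\ weight a, weight b & x ^+ a * y ^+ b = 1]) \/
  (forall z, exists a b, [/\ a < n, b < n & z = x ^+ a * y ^+ b]).
Proof.
move=> ox oy; have [tiI | ] := eqVneq (<[x]> :&: <[y]>) 1.
  right=> z.
  have : z \in <[x]> * <[y]>.
    suff -> : <[x]> * <[y]> = [set: G] by rewrite inE.
    apply/eqP; rewrite eqEcard subsetT cardG TI_cardMg //.
    by rewrite -!orderE ox oy mulnn leqnn.
  case/mulsgP=> _ _ /cyclePmin[a lt_a ->] /cyclePmin[b lt_b ->] ->.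
  by rewrite ox in lt_a; rewrite oy in lt_b; exists a, b.
case/trivgPn=> t /setIP[/cyclePmin[a lt_a ta] /cyclePmin[b lt_b tb]] t1; left.
rewrite ox in lt_a; rewrite oy in lt_b.
have a_gt0 : 0 < a by case: (a) ta t1 => // ->; rewrite eqxx.
have b_gt0 : 0 < b by case: (b) tb t1 => // ->; rewrite eqxx.
exists (n - a), b; split; [exact: weight_sub | exact: weight_lt |].
by rewrite expg_subn // -ta -tb mulVg.
Qed.

(** The alternatives record which exponents in [z = x ^+ a * y ^+ b] vanish: for [a = 0] the terms
    [y], [z] cancel, for [b = 0] the last alternative holds, and otherwise all three terms
    cancel. *)
Lemma power_or_weight (x y z : G) : #[x] = n -> #[y] = n -> #[z] = n ->
  [\/ exists a b, [/\ weight a, weight b & x ^+ a * y ^+ b = 1],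
      exists a b, [/\ weight a, weight b & y ^+ a * z ^+ b = 1],
      exists a b c, [/\ weight a, weight b, weight c
                      & x ^+ a * y ^+ b * z ^+ c = 1]
    | exists a, [/\ 0 < a, a < n & z = x ^+ a]].
Proof.
move=> ox oy oz; have [|/(_ z)[a [b [lt_a lt_b def_z]]]] := span_or_weight ox oy.
  by constructor 1.
case: (posnP a) => [a0 | a_gt0].
  (* With both exponents zero, [z] would be 1, of order 1 instead of [n]. *)
  have b_gt0 : 0 < b.
    case: posnP => // b0; move: n_gt1; rewrite -oz def_z a0 b0 !expg0 mulg1.
    by rewrite order1.
  constructor 2; exists (n - b), 1%N; split => //; first exact: weight_sub.
  by rewrite def_z a0 expg0 mul1g expg_subn // expg1 mulVg.
case: (posnP b) => [b0 | b_gt0].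
  by constructor 4; exists a; rewrite def_z b0 expg0 mulg1.
constructor 3; exists (n - a), (n - b), 1%N.
split => //; try exact: weight_sub.
by rewrite !expg_subn // expg1 def_z -invMg (commG (y ^+ b)) mulVg.
Qed.

Lemma weighted_consecutive_bound4 : weighted_consecutive_bound G weight 4.
Proof.
case=> [|x [|y [|z [|w s]]]] // _.
have block1 i a : i < 4 -> weight a -> nth 1 [:: x, y, z, w & s] i ^+ a = 1 ->
    has_weighted_consecutive_product_one weight [:: x, y, z, w & s].
  move=> lt_i wa e1; apply: (@weighted_block _ _ _ i [:: a]) => //.
  - by rewrite addn1 !ltnS (@leq_trans 3).
  - by move=> k; rewrite inE => /eqP->.
  - by rewrite big_nat1 addn0.
have block2 i : i < 3 ->
    (exists a b, [/\ weight a, weight b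
      & nth 1 [:: x, y, z, w & s] i ^+ a *
        nth 1 [:: x, y, z, w & s] i.+1 ^+ b = 1]) ->
    has_weighted_consecutive_product_one weight [:: x, y, z, w & s].
  move=> lt_i [a [b [wa wb e1]]]; apply: (@weighted_block _ _ _ i [:: a; b]) => //.
  - by rewrite addn2 !ltnS (@leq_trans 2).
  - by move=> k; rewrite !inE => /orP[]/eqP->.
  - by rewrite big_ltn // big_nat1 addn0 addn1.
have block3 i : i < 2 ->
    (exists a b c, [/\ weight a, weight b, weight c
      & nth 1 [:: x, y, z, w & s] i ^+ a *
        nth 1 [:: x, y, z, w & s] i.+1 ^+ b *
        nth 1 [:: x, y, z, w & s] i.+2 ^+ c = 1]) ->
    has_weighted_consecutive_product_one weight [:: x, y, z, w & s].
  move=> lt_i [a [b [c [wa wb wc e1]]]].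
  apply: (@weighted_block _ _ _ i [:: a; b; c]) => //.
  - by rewrite addn3 !ltnS (@leq_trans 1).
  - by move=> k; rewrite !inE => /or3P[]/eqP->.
  - by do 3 rewrite big_ltn //; rewrite big_geq // mulg1 addn0 addn1 addn2 mulgA.
case: (order_eq_or_weight x) => [ox | [a wa xa]]; last exact: (@block1 0%N a).
case: (order_eq_or_weight y) => [oy | [a wa ya]]; last exact: (@block1 1%N a).
case: (order_eq_or_weight z) => [oz | [a wa za]]; last exact: (@block1 2%N a).
case: (order_eq_or_weight w) => [ow | [a wa w1]]; last exact: (@block1 3%N a).
case: (power_or_weight ox oy oz) => [|||[a [a_gt0 lt_a za]]].
- exact: (@block2 0%N).
- exact: (@block2 1%N).
- exact: (@block3 0%N).
case: (power_or_weight oy oz ow) => [|||[b [b_gt0 lt_b wb]]].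
- exact: (@block2 1%N).
- exact: (@block2 2%N).
- exact: (@block3 1%N).
(* Now [z = x ^+ a] and [w = y ^+ b], so these weights turn the product into a commutator of
   [x ^+ a] and [y ^+ b], trivial in an abelian group. *)
apply: (@weighted_block _ _ _ 0%N [:: n - a; n - b; 1%N; 1%N]) => //.
  by move=> k; rewrite !inE => /or4P[]/eqP-> //; exact: weight_sub.
do 4 rewrite big_ltn //; rewrite big_geq //= mulg1 !expg_subn // !expg1 wb za.
by rewrite (commG (x ^+ a)) mulKg mulVg.
Qed.

End ExponentN.

Lemma expg_pair (G H : groupType) (x : G * H) (k : nat) :
  x ^+ k = (x.1 ^+ k, x.2 ^+ k).
Proof. by elim: k => [//|k IHk]; rewrite !expgS IHk. Qed.

Lemma prod_expg_pair (G H : groupType) (x : nat -> G * H) (a : nat -> nat)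
    (i j : nat) :
  \prod_(i <= t < j) x t ^+ a t =
  (\prod_(i <= t < j) (x t).1 ^+ a t, \prod_(i <= t < j) (x t).2 ^+ a t).
Proof.
elim/big_ind3: _ => [//|x1 x2 _ y1 y2 _ -> ->|t _] //.
exact: expg_pair.
Qed.

Theorem theorem4p4 (n : nat) (hn : 2 <= n)
    (C : finGroupType) (hC : cyclic [set: C]) (hcard : #|[set: C]| = n) :
  is_weighted_C (C * C)%type (fun a : nat => 1 <= a <= n - 1) 4.
Proof.
have abC := cyclic_abelian hC.
split=> //.
  apply: weighted_consecutive_bound4 => //.
  - apply/centsP=> -[a b] _ [c d] _; congr (_, _);
      by apply: (centsP abC); rewrite inE.
  - have expC (a : C) : a ^+ n = 1 by rewrite -hcard expg_cardG ?inE.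
    by move=> x; rewrite expg_pair !expC.
  - by rewrite cardsT card_prod -cardsT hcard mulnn.
move=> m _ bound; rewrite leqNgt; apply/negP=> lt_m.
have [g gC] := cyclicP hC.
have og : #[g] = n by rewrite orderE -gC.
have g_neq1 a : 1 <= a <= n - 1 -> g ^+ a <> 1.
  case/andP=> a0 an /eqP; rewrite -order_dvdn og => /(dvdn_leq a0).
  by rewrite leqNgt (leq_ltn_trans an) // subn1 prednK // ltnW.
(* Since [m] is at most 3, the bound applies to this sequence of length 3. *)
have [//|i [j [a [le_ij lt_j wa]]]] :=
  bound [:: (g, 1); (1, g); (g, 1)] _.
rewrite prod_expg_pair => -[].
(* Six blocks remain. The four containing index 1 leave [g ^+ a 1] as second coordinate; the two
   single outer terms are refuted by the first coordinate. *)
case: i le_ij wa => [|[|[|i]]]; case: j lt_j => [|[|[|j]]] //= _ _ wa;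
  rewrite unlock /= ?expg1n ?mul1g ?mulg1 => e1 e2.
- by case: (g_neq1 (a 0%N)); first exact: wa.
- by case: (g_neq1 (a 1%N)); first exact: wa.
- by case: (g_neq1 (a 1%N)); first exact: wa.
- by case: (g_neq1 (a 1%N)); first exact: wa.
- by case: (g_neq1 (a 1%N)); first exact: wa.
- by case: (g_neq1 (a 2)); first exact: wa.
Qed.
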